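(* Let $T$ be a contraction on a complex Hilbert space $\mathcal{H}$. Then $T$ is a minimal element for Harnack domination if and only if $T$ is an isometry or a coisometry.
   Context: A contraction on $\mathcal{H}$ is a bounded linear operator of norm at most $1$. For contractions $T,T'$ on $\mathcal{H}$, $T$ is Harnack dominated by $T'$ (written $T \prec T'$) if there is a constant $c\ge 1$ such that $\operatorname{Re} p(T)\le c\,\operatorname{Re} p(T')$ for every analytic polynomial $p$ with $\operatorname{Re} p(z)\ge 0$ for all $|z|\le 1$; here $\operatorname{Re} A=\frac12(A+A^* )$ for an operator $A$. A contraction $T$ on $\mathcal{H}$ is minimal for Harnack domination if, for contractions $T'$ on $\mathcal{H}$, $T'\prec T$ implies $T'=T$. A coisometry is an operator whose adjoint is an isometry. *)

(* Defs.v *)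
From mathcomp Require Export all_boot all_order all_algebra complex.
From mathcomp Require Export all_classical all_reals all_analysis.
Export Order.TTheory GRing.Theory Num.Theory.
Export numFieldNormedType.Exports.

Set Implicit Arguments.
Unset Strict Implicit.
Unset Printing Implicit Defensive.

Local Open Scope classical_set_scope.
Local Open Scope ring_scope.
Local Open Scope complex_scope.

Section HarnackDomination.
Context {R : realType} {H : completeNormedModType R[i]}.
Implicit Types (f : {dot H for Num.conj}) (T A B : H -> H) (p : {poly R[i]}).

(* With [dot_norm f], the complete normed module [H] is a complex Hilbert space
   whose inner product [f], linear in its first argument, induces its norm. *)
Definition dot_norm f : Prop := forall x : H, `|x| ^+ 2 = f x x.

(* [adjoint f A y] is the z such that f (A x) y = f x z for all x. It is unique
   as [f] is definite; for a bounded linear [A] on a Hilbert space it exists by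
   the Riesz representation theorem, so that the default value 0 is not used. *)
Definition adjoint f A : H -> H :=
  fun y => xget 0 [set z : H | forall x : H, f (A x) y = f x z].

Definition op_contraction T : Prop := forall x : H, `|T x| <= `|x|.

Definition isometric T : Prop := forall x : H, `|T x| = `|x|.

Definition coisometric f T : Prop := isometric (adjoint f T).

Definition op_horner p T : H -> H :=
  fun x => \sum_(i < size p) p`_i *: iter i T x.

Definition op_Re f A : H -> H := fun x => 2^-1 *: (A x + adjoint f A x).

(* In [R[i]], 0 <= z means that z is real and nonnegative. *)
Definition op_le f A B : Prop := forall x : H, 0 <= f (B x - A x) x.

Definition harnack_dominated f T T' : Prop :=
  exists c : R, 1 <= c /\
    forall p, (forall z : R[i], `|z| <= 1 -> 0 <= complex.Re p.[z]) ->
      op_le f (op_Re f (op_horner p T))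
              (fun x => c%:C *: op_Re f (op_horner p T') x).

Definition harnack_minimal f (T : {linear H -> H}) : Prop :=
  forall T' : {linear H -> H}, op_contraction T' ->
    harnack_dominated f T' T -> T' =1 T.

End HarnackDomination.

(* Main.v *)
From HB Require Import structures.
Require Import Defs.
From mathcomp Require Import cyclic separable cyclotomic ring lra.

(** Harnack domination only needs to be tested on the Fejer polynomials
    [fejer n w], [`|w| = 1], whose real part on the circle is a Fejer kernel: for
    a polynomial [p] with nonnegative real part, averaging the Fejer inequality
    against [Re p] over roots of unity yields the inequality for the Cesaro means
    of [p], hence for [p] ([fejer_domination]). For a contraction [T] and the orbit
    sums [s j], the sums of [w ^+ k *: iter k T x] over [k < j], the real part of
    [<fejer n w (T) x, x>] is [|s n|^2] plus the sum over [j < n] of the defects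
    [|s j|^2 - |T (s j)|^2] ([fejer_formE]).

    Isometries and coisometries are minimal. If [S] is dominated by [T] and [T]
    keeps the norm of [h], then averaging the Fejer inequality at the vectors
    [h - w *: T h] over [w] bounds [n * (|h|^2 - Re <S h, T h>)] independently of
    [n], so [Re <S h, T h> >= |h|^2] and [S h = T h] ([harnack_rigidity]). This
    settles the isometric case at once; a coisometry is isometric on the range of
    its adjoint, and from there the adjoints of [S] and [T] are seen to agree.

    Other contractions are not minimal. If [T] is neither isometric nor
    coisometric, then both defect operators [1 - T^* T] and [1 - T T^* ] are
    nonzero. Perturb [T] by a small rank one operator [<., u> v] with [u] in the
    range of the first and [v] in the range of the second. The unitarity of the
    Julia operator ([julia]) shows that feeding vectors from the range of
    [1 - T T^* ] into the iteration of [T] costs no more than their squared norms,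
    and those are paid for by the defects of [T]. So the orbit sums of the
    perturbed operator stay close to those of [T] ([orbit_sum_diff]), and the Fejer
    forms compare up to a constant ([perturbation_fejer], [not_minimal]).

    The adjoint of a contraction exists by the Riesz representation theorem,
    which is proved by minimizing a quadratic functional ([riesz]). *)

Set Implicit Arguments.
Unset Strict Implicit.
Unset Printing Implicit Defensive.
Local Open Scope classical_set_scope.
Local Open Scope ring_scope.
Local Open Scope complex_scope.
Import ComplexField.Normc.
(* In this scope ^* would denote [conjc], only convertible to [Num.conj]. *)
Local Notation "z ^*" := (Num.conj z) : complex_scope.

(** * Real parts and moduli of complex numbers *)

Section ComplexNumbers.
Variable R : realType.
Implicit Types z w : R[i].

Lemma ReD z w : complex.Re (z + w) = complex.Re z + complex.Re w.
Proof. by case: z w => [a b] [c d]. Qed.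

Lemma ReN z : complex.Re (- z) = - complex.Re z.
Proof. by case: z. Qed.

Lemma Re_sum (I : Type) (r : seq I) (P : pred I) (F : I -> R[i]) :
  complex.Re (\sum_(i <- r | P i) F i) = \sum_(i <- r | P i) complex.Re (F i).
Proof. exact: (big_morph _ ReD). Qed.

Lemma ReM_real (r : R) z : complex.Re (r%:C * z) = r * complex.Re z.
Proof. by case: z => a b /=; rewrite mul0r subr0. Qed.

Lemma ReM_nat n z : complex.Re (n%:R * z) = n%:R * complex.Re z.
Proof. by rewrite -(rmorph_nat (real_complex R)) ReM_real. Qed.

Lemma Re_conj z : complex.Re z^* = complex.Re z.
Proof. by case: z. Qed.

Lemma conj_real (c : R) : c%:C^* = c%:C.
Proof. exact: conjc_real. Qed.

Lemma normc_ge0 z : 0 <= normc z.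
Proof. by case: z => a b; exact: sqrtr_ge0. Qed.

Lemma normc_sqr z : complex.Re (z * z^*) = normc z ^+ 2.
Proof.
case: z => a b /=; rewrite sqr_sqrtr ?addr_ge0 ?sqr_ge0 //.
by rewrite mulrN opprK !expr2.
Qed.

Lemma eq_Re z w : complex.Re z = complex.Re w ->
  complex.Re ('i * z) = complex.Re ('i * w) -> z = w.
Proof.
case: z w => [a b] [c d] /= ->.
by rewrite !mul0r !mul1r !sub0r => /oppr_inj ->.
Qed.

End ComplexNumbers.

(** The quadratic has its minimum at 0, so its derivative there vanishes. *)
Lemma quadratic_ge0 (R : realType) (a s : R) : 0 <= s ->
  (forall t, 0 <= 2 * t * a + 2 * t ^+ 2 * s) -> a = 0.
Proof.
(* The minimizer of the quadratic, with s + 1 for s to cover s = 0. *)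
move=> s0 /(_ (- a / (2 * (s + 1)))).
rewrite [leRHS](_ : _ = - (a ^+ 2) * ((s + 2) / (2 * (s + 1) ^+ 2))); last first.
  by field; lra.
rewrite mulNr oppr_ge0 pmulr_lle0; last first.
  by rewrite divr_gt0 ?mulr_gt0 ?exprn_gt0; lra.
by rewrite le_eqVlt ltNge sqr_ge0 orbF sqrf_eq0 => /eqP.
Qed.

(** * The real inner product and completeness *)

Section InnerProduct.
Variables (R : realType) (H : completeNormedModType R[i]).
Variable f : {dot H for Num.conj}.
Implicit Types x y z : H.

(** [R[i]] is only partially ordered, so all estimates are made on the real
    part of the form, which is a real inner product with the same squared norm. *)
Definition ip x y : R := complex.Re (f x y).
Definition sqn x : R := ip x x.

Lemma form_conj x y : f x y = (f y x)^*.
Proof. by rewrite hermC mul1r. Qed.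

Lemma formDl x y z : f (x + y) z = f x z + f y z.
Proof. exact: linearDl. Qed.

Lemma formDr x y z : f x (y + z) = f x y + f x z.
Proof. exact: linearDr. Qed.

Lemma formZl a x y : f (a *: x) y = a * f x y.
Proof. exact: linearZl_LR. Qed.

Lemma formZr a x y : f x (a *: y) = a^* * f x y.
Proof. exact: linearZr_LR. Qed.

Lemma ipC x y : ip x y = ip y x.
Proof. by rewrite /ip form_conj Re_conj. Qed.

Lemma ipDl x y z : ip (x + y) z = ip x z + ip y z.
Proof. by rewrite /ip linearDl ReD. Qed.

Lemma ipDr x y z : ip x (y + z) = ip x y + ip x z.
Proof. by rewrite /ip linearDr ReD. Qed.

Lemma ipNl x y : ip (- x) y = - ip x y.
Proof. by rewrite /ip linearNl ReN. Qed.

Lemma ipNr x y : ip x (- y) = - ip x y.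
Proof. by rewrite /ip linearNr ReN. Qed.

Lemma ipZl (r : R) x y : ip (r%:C *: x) y = r * ip x y.
Proof. by rewrite /ip linearZl_LR ReM_real. Qed.

Lemma ipZr (r : R) x y : ip x (r%:C *: y) = r * ip x y.
Proof. by rewrite ipC ipZl ipC. Qed.

Lemma form_sqn x : f x x = (sqn x)%:C.
Proof. by rewrite /sqn /ip RRe_real ?ger0_real ?dnorm_ge0. Qed.

Lemma sqn_ge0 x : 0 <= sqn x.
Proof. by rewrite -ler0c -form_sqn dnorm_ge0. Qed.

Lemma sqn_eq0 x : sqn x = 0 -> x = 0.
Proof. by move=> x0; apply/eqP; rewrite -(dnorm_eq0 f) form_sqn x0. Qed.

Lemma sqnD x y : sqn (x + y) = sqn x + 2 * ip x y + sqn y.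
Proof. by rewrite /sqn ipDl !ipDr (ipC y x); ring. Qed.

Lemma sqnN x : sqn (- x) = sqn x.
Proof. by rewrite /sqn ipNl ipNr opprK. Qed.

Lemma sqnB x y : sqn (x - y) = sqn x - 2 * ip x y + sqn y.
Proof. by rewrite sqnD ipNr sqnN; ring. Qed.

Lemma sqnZ a x : sqn (a *: x) = normc a ^+ 2 * sqn x.
Proof.
rewrite -normc_sqr {1}/sqn /ip linearZl_LR linearZr_LR /= mulrA form_sqn.
by rewrite mulrC ReM_real mulrC.
Qed.

Hypothesis f_norm : dot_norm f.

Lemma sqn_norm x : (sqn x)%:C = `|x| ^+ 2.
Proof. by rewrite f_norm form_sqn. Qed.

Lemma sqn_le x y : (sqn x <= sqn y) = (`|x| <= `|y|).
Proof. by rewrite -lecR !sqn_norm ler_sqr ?nnegrE. Qed.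

Lemma sqn_eq x y : `|x| = `|y| <-> sqn x = sqn y.
Proof.
by split=> [e|e]; [apply: complexI; rewrite !sqn_norm e|
  apply: le_anti; rewrite -!sqn_le e lexx].
Qed.

Lemma sqn_lt x (e : R[i]) : 0 < e ->
  sqn x < complex.Re e ^+ 2 -> `|x| < e.
Proof.
move=> e0; rewrite -ltcR sqn_norm rmorphXn /= (RRe_real (gtr0_real e0)).
by rewrite ltr_sqr ?nnegrE ?normr_ge0 // (ltW e0).
Qed.

(** Completeness of [H] in terms of real squared distances, which spares the
    complex-valued norm in the construction of the Riesz vector. *)
Lemma sqn_complete (u : nat -> H) :
  (forall e : R, 0 < e -> exists N, forall n, (N <= n)%N ->
    sqn (u N - u n) < e) ->
  exists z, forall e : R, 0 < e -> exists N, forall n, (N <= n)%N ->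
    sqn (z - u n) < e.
Proof.
move=> u_cauchy.
have Re_gt0 (e : R[i]) : 0 < e -> 0 < complex.Re e.
  by move=> e0; rewrite -ltcR (RRe_real (gtr0_real e0)).
have u_cvg : cvg (u @ \oo).
  apply: cauchy_cvg; apply: cauchy_exP => e e0.
  have [N uN] := u_cauchy _ (exprn_gt0 2 (Re_gt0 _ e0)).
  exists (u N); exists N => // n /= /uN.
  by rewrite -ball_normE /=; exact: sqn_lt.
exists (lim (u @ \oo)) => e e0.
have e0C : 0 < (Num.sqrt e)%:C :> R[i] by rewrite ltcR sqrtr_gt0.
have /cvgrPdist_lt /(_ _ e0C) [N _ uN] := u_cvg; exists N => n /uN /= lt_n.
rewrite -ltcR sqn_norm -(sqr_sqrtr (ltW e0)) rmorphXn /=.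
by rewrite ltr_sqr ?nnegrE ?normr_ge0 // (ltW e0C).
Qed.

(** * Riesz representation and adjoints *)

Section Riesz.
Variable phi : H -> R[i].
Variable c : R.
Hypothesis phiD : forall x y, phi (x + y) = phi x + phi y.
Hypothesis phiZ : forall a x, phi (a *: x) = a * phi x.
Hypothesis phi_bd : forall x, 2 * complex.Re (phi x) <= sqn x + c.

Let J x := sqn x - 2 * complex.Re (phi x).

Let JD x y : J (x + y) = J x + 2 * (ip x y - complex.Re (phi y)) + sqn y.
Proof. by rewrite /J sqnD phiD ReD; ring. Qed.

(** The representing vector minimizes [J]. By the parallelogram law two
    almost-minimizers are close to each other ([close]), so a minimizing sequence
    converges, and the vanishing first variation of [J] at its limit says that
    the real parts of [phi x] and [f x z] agree; replacing [x] by ['i *: x] gives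
    the imaginary parts. The hypothesis [phi_bd] bounds [J] below. *)
Lemma riesz : exists z, forall x, phi x = f x z.
Proof.
pose E : set R := range J.
have E_lb : lbound E (- c).
  by move=> _ [x _ <-]; rewrite /J; have := phi_bd x; lra.
have E_inf : has_inf E by split; [exists (J 0), 0 | exists (- c)].
pose m := inf E.
have m_le x : m <= J x by apply: ge_inf; [exists (- c) | exists x].
have near_min (e : R) : 0 < e -> exists x, J x < m + e.
  by move=> e0; have [_ [x _ <-] lt_x] := inf_adherent e0 E_inf; exists x.
have inv_gt0 n : (0 : R) < n.+1%:R^-1 by rewrite invr_gt0.
pose u n := sval (cid (near_min _ (inv_gt0 n))).
have uP n : J (u n) < m + n.+1%:R^-1 by rewrite /u; case: cid.
have close x y : sqn (x - y) <= 2 * (J x - m) + 2 * (J y - m).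
  have -> : J y = J (x + (y - x)) by rewrite addrC subrK.
  rewrite -(sqnN (x - y)) opprB; move: (y - x) => d.
  have := m_le (x + (2^-1)%:C *: d).
  rewrite !JD phiZ ReM_real /sqn !ipZr !ipZl; lra.
have small (e : R) : 0 < e -> exists N, forall n, (N <= n)%N -> J (u n) - m < e.
  move=> e0; have [N _ eN] := near_infty_natSinv_lt (PosNum e0).
  exists N => n /eN lt_n; rewrite ltrBlDl; apply: lt_trans (uP n) _.
  by rewrite ltrD2l; exact: lt_n.
have [e e0|z zP] := sqn_complete (u := u).
  have [|N uN] := small (e / 4); first by lra.
  exists N => n Nn; apply: le_lt_trans (close _ _) _.
  by have := uN _ Nn; have := uN _ (leqnn N); lra.
have re_eq x : complex.Re (phi x) = ip x z.
  pose A := ip z x - complex.Re (phi x).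
  have quad (t : R) : 0 <= 2 * t * A + 2 * t ^+ 2 * sqn x.
    apply/ler_addgt0Pl => e e0.
    have [|N uN] := small (e / 2); first by lra.
    have [|N' zN] := zP (e / 2); first by lra.
    pose w := u (maxn N N').
    have w1 : J w - m < e / 2 by apply: uN; rewrite leq_maxl.
    have w2 : sqn (z - w) < e / 2 by apply: zN; rewrite leq_maxr.
    have := m_le (w + t%:C *: x); rewrite JD phiZ ReM_real ipZr.
    have := sqn_ge0 ((z - w) + t%:C *: x); rewrite sqnD ipZr ipDl ipNl.
    have -> : sqn (t%:C *: x) = t ^+ 2 * sqn x by rewrite /sqn ipZl ipZr; ring.
    rewrite /A; set a := ip z x; set b := ip w x; set r := complex.Re _.
    set S := sqn x; lra.
  have A0 := quadratic_ge0 (sqn_ge0 x) quad.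
  by move: A0; rewrite /A ipC; lra.
exists z => x; apply: eq_Re; first exact: re_eq.
by have := re_eq ('i *: x); rewrite phiZ /ip linearZl_LR.
Qed.

End Riesz.

End InnerProduct.

Section Adjoint.
Variables (R : realType) (H : completeNormedModType R[i]).
Variable f : {dot H for Num.conj}.
Implicit Types (x y z : H) (A B : H -> H).

Definition has_adjoint A := forall y, exists z, forall x, f (A x) y = f x z.

Lemma adjointP A : has_adjoint A -> forall x y, f (A x) y = f x (adjoint f A y).
Proof.
move=> hA x y; rewrite /adjoint; case: xgetP => [z _ ->|/(_ _) h] //.
by have [z] := hA y; move/h.
Qed.

Lemma form_inj y z : (forall x, f x y = f x z) -> y = z.
Proof.
move=> e; apply/subr0_eq/(@sqn_eq0 _ _ f).
by rewrite /sqn ipDr ipNr /ip e subrr.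
Qed.

Lemma has_adjoint_sum n (B : nat -> H -> H) (a : nat -> R[i]) :
  (forall k, has_adjoint (B k)) ->
  has_adjoint (fun x => \sum_(k < n) a k *: B k x).
Proof.
move=> hB y; elim: n => [|n [z IH]].
  by exists 0 => x; rewrite big_ord0 linear0l linear0r.
have [w hw] := hB n y; exists (z + (a n)^* *: w) => x.
by rewrite big_ord_recr /= formDl formDr IH formZl formZr hw conjCK.
Qed.

Lemma has_adjoint_iter A k : has_adjoint A -> has_adjoint (iter k A).
Proof.
move=> hA; elim: k => [|k IH] y; first by exists y.
have [z hz] := hA y; have [w hw] := IH z.
by exists w => x; rewrite iterS hz hw.
Qed.

Lemma has_adjoint_horner p A : has_adjoint A -> has_adjoint (op_horner p A).
Proof.
move=> hA; rewrite /op_horner.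
by apply: (@has_adjoint_sum _ (fun k => iter k A) (fun k => p`_k)) => k;
  exact: has_adjoint_iter.
Qed.

Hypothesis f_norm : dot_norm f.
Variable T : {linear H -> H}.
Hypothesis T_contr : op_contraction T.

Lemma contraction_sqn x : sqn f (T x) <= sqn f x.
Proof. by rewrite sqn_le. Qed.

(** The bound needed for the Riesz vector comes from
    [0 <= sqn (T x - y)], without a Cauchy-Schwarz inequality. *)
Lemma contraction_has_adjoint : has_adjoint T.
Proof.
move=> y; apply: (riesz f_norm (c := sqn f y)) => [x x'|a x|x].
- by rewrite linearD linearDl.
- by rewrite linearZ linearZl_LR.
have := sqn_ge0 f (T x - y); rewrite sqnB -/(ip f (T x) y).
by have := contraction_sqn x; lra.
Qed.

End Adjoint.

(** * Fejer polynomials *)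

Section Fejer.
Variable R : realType.

(** The coefficients of the polynomial
    [n + 2 * \sum_(0 < k < n) (n - k) * 'X^k], whose real part on the unit circle is
    the Fejer kernel [`|1 + z + ... + z ^+ n.-1| ^+ 2]. *)
Definition fejer_coef n k : nat := ((n - k) * (k != 0).+1)%N.

Definition fejer n (w : R[i]) : {poly R[i]} :=
  \poly_(k < n) (w ^+ k *+ fejer_coef n k).

(** The recursion behind every telescoping below, stated for sequences in an
    additive group so that it applies both to powers of a number and to the
    orbit of a vector. *)
Lemma fejer_sumS (V : zmodType) (u : nat -> V) n :
  \sum_(k < n.+1) u k *+ fejer_coef n.+1 k =
  \sum_(k < n) u k *+ fejer_coef n k + (u 0 + (\sum_(k < n) u k.+1) *+ 2).
Proof.
have -> : \sum_(k < n) u k *+ fejer_coef n k =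
    \sum_(k < n.+1) u k *+ fejer_coef n k.
  by rewrite big_ord_recr /= /fejer_coef subnn mul0n mulr0n addr0.
have -> : u 0 + (\sum_(k < n) u k.+1) *+ 2 =
    \sum_(k < n.+1) u k *+ (nat_of_ord k != 0)%N.+1.
  by rewrite big_ord_recl /= -sumrMnl; congr (_ + _); apply: eq_bigr.
rewrite -big_split /=; apply: eq_bigr => k _.
by rewrite -mulrnDr /fejer_coef subSn 1?mulSn 1?addnC // -ltnS ltn_ord.
Qed.

Lemma fejer_hornerE n w z :
  (fejer n w).[z] = \sum_(k < n) (w * z) ^+ k *+ fejer_coef n k.
Proof.
rewrite horner_poly; apply: eq_bigr => k _.
by rewrite mulrnAl exprMn.
Qed.

(** Induction with the stronger bound [`|1 + ... + (w * z) ^+ n.-1| ^+ 2]: the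
    step is [`|1 + v| ^+ 2 = 1 + 2 * Re v + `|v| ^+ 2], where [v] is [w * z] times
    the previous sum and so is not larger than it. *)
Lemma fejer_Re_ge0 n w z : normc w = 1 -> `|z| <= 1 ->
  0 <= complex.Re (fejer n w).[z].
Proof.
move=> w1; rewrite fejer_hornerE => z1.
have wz1 : normc (w * z) <= 1 by rewrite normcM w1 mul1r -lecR.
apply: le_trans (sqr_ge0 (normc (\sum_(k < n) (w * z) ^+ k))) _.
elim: n => [|n IH]; first by rewrite !big_ord0 normc0 expr0n.
rewrite fejer_sumS ReD -lerBlDr; apply: le_trans IH.
rewrite big_ord_recl expr0 /=.
have -> : \sum_(i < n) (w * z) ^+ i.+1 = w * z * \sum_(i < n) (w * z) ^+ i.
  by rewrite mulr_sumr; apply: eq_bigr => i _; rewrite exprS.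
move: (\sum_(i < n) _) => t.
have : normc (w * z * t) ^+ 2 <= normc t ^+ 2.
  rewrite normcM exprMn ler_piMl ?sqr_ge0 //.
  by rewrite expr_le1 // normc_ge0.
move: (w * z * t) => v; rewrite -!normc_sqr.
case: v t => [a b] [c d] /=; lra.
Qed.

End Fejer.

(** * Fejer polynomials of a contraction and of its perturbations *)

Section Functional.
Variables (R : realType) (H : completeNormedModType R[i]).
Variable f : {dot H for Num.conj}.
Implicit Types (x y z : H) (p : {poly R[i]}).

Lemma op_hornerE p (T : H -> H) n x : (size p <= n)%N ->
  op_horner p T x = \sum_(k < n) p`_k *: iter k T x.
Proof.
move=> le_n; rewrite /op_horner -(subnKC le_n) big_split_ord /=.
rewrite [X in _ + X]big1 ?addr0 // => k _.
by rewrite nth_default ?scale0r // leq_addr.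
Qed.

(** The sum of [w ^+ k *: iter k T x] over [k < n], written as the iteration
    that perturbation arguments can follow step by step. *)
Definition orbit_sum (T : H -> H) (w : R[i]) x n :=
  iter n (fun v => x + w *: T v) 0.

Lemma orbit_sumS (T : H -> H) w x n :
  orbit_sum T w x n.+1 = x + w *: T (orbit_sum T w x n).
Proof. by []. Qed.

Lemma orbit_sumE (T : {linear H -> H}) w x n :
  w *: T (orbit_sum T w x n) = \sum_(k < n) w ^+ k.+1 *: iter k.+1 T x.
Proof.
elim: n => [|n IH]; first by rewrite big_ord0 /= linear0 scaler0.
rewrite big_ord_recl /= linearD scalerDr expr1; congr (_ + _).
rewrite IH linear_sum scaler_sumr; apply: eq_bigr => k _.
by rewrite linearZ /= scalerA -exprS.
Qed.

(** The quadratic form of the squared defect operator [1 - T^* T]. *)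
Definition defect (T : H -> H) x : R := sqn f x - sqn f (T x).

(** The value of the [n]-th Fejer polynomial at [T], as a sum that is termwise
    nonnegative when [T] is a contraction, so that two contractions can be
    compared through their orbit sums and defects. *)
Definition fejer_form (T : H -> H) w x n : R :=
  sqn f (orbit_sum T w x n) + \sum_(j < n) defect T (orbit_sum T w x j).

(** With [s n] for the orbit sums, the added term of the recursion is
    [sqn x + 2 * ip (w *: T (s n)) x], which is
    [sqn (s n.+1) - sqn (T (s n))] since [s n.+1 = x + w *: T (s n)] and
    [`|w| = 1]; these differences telescope up to the defects. *)
Lemma fejer_formE (T : {linear H -> H}) w x n : normc w = 1 ->
  ip f (op_horner (fejer n w) T x) x = fejer_form T w x n.
Proof.
move=> w1; rewrite (op_hornerE _ _ (size_poly _ _)).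
under eq_bigr => k _ do rewrite coef_poly ltn_ord -scalerMnl.
elim: n => [|n IH].
  by rewrite /fejer_form !big_ord0 /ip !linear0l /sqn /ip linear0l addr0.
rewrite (fejer_sumS (fun k => w ^+ k *: iter k T x)) /= expr0 scale1r.
rewrite -[X in X *+ 2](orbit_sumE T w x n) ipDl IH /fejer_form big_ord_recr /=.
rewrite sqnD [defect T (orbit_sum T w x n)]/defect.
have -> : sqn f (w *: T (orbit_sum T w x n)) = sqn f (T (orbit_sum T w x n)).
  by rewrite sqnZ w1 expr1n mul1r.
by rewrite mulr2n !ipDl -/(sqn f x) (ipC f x); ring.
Qed.

Hypothesis f_norm : dot_norm f.

Section Contraction.
Variable T : {linear H -> H}.
Hypothesis T_contr : op_contraction T.

Lemma defect_ge0 x : 0 <= defect T x.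
Proof. by rewrite subr_ge0 contraction_sqn. Qed.

Lemma defect_le x : defect T x <= sqn f x.
Proof. by rewrite gerBl sqn_ge0. Qed.

(** Parallelogram law for the nonnegative quadratic form [defect T]. *)
Lemma defectD_le x y : defect T (x + y) <= 2 * defect T x + 2 * defect T y.
Proof.
have := defect_ge0 (x - y).
by rewrite /defect !linearD linearN !sqnD !ipNr !sqnN; lra.
Qed.

Lemma adjoint_sqn_le y z : (forall x, ip f (T x) y = ip f x z) ->
  sqn f z <= sqn f y.
Proof.
move=> adj; have := sqn_ge0 f (T z - y).
have := contraction_sqn f_norm T_contr z.
by rewrite sqnB adj -/(sqn f z); lra.
Qed.

(** Here [z] is the value at [y] of the adjoint of [T], so that [y - T z] is
    the squared defect operator of the adjoint applied to [y]. The identity says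
    that the Julia operator, which couples [T] with the two defect operators, is
    isometric; the square roots cancel out of it. *)
Lemma julia x y z : (forall x', ip f (T x') y = ip f x' z) ->
  sqn f (T x + (y - T z)) = sqn f x + sqn f y - sqn f z - defect T (x - z).
Proof.
move=> adj; rewrite addrCA -linearB addrC sqnD adj.
by rewrite /defect ipDl ipNl -/(sqn f z) (sqnB f x z); ring.
Qed.

Lemma julia_le x y z : (forall x', ip f (T x') y = ip f x' z) ->
  sqn f (T x + (y - T z)) <= sqn f x + sqn f y - defect T x / 2.
Proof.
move=> adj; rewrite (julia x adj); have := defectD_le (x - z) z.
by rewrite subrK; have := defect_le z; lra.
Qed.

Lemma julia_ge x y z : (forall x', ip f (T x') y = ip f x' z) ->
  sqn f x - 2 * sqn f y - 2 * defect T x <= sqn f (T x + (y - T z)).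
Proof.
move=> adj; rewrite (julia x adj); have := defectD_le x (- z).
have := adjoint_sqn_le adj; have := defect_le (- z); have := sqn_ge0 f y.
by rewrite sqnN; lra.
Qed.

Section Perturbation.
Variables (T' : {linear H -> H}) (y z : H -> H).
Hypothesis yz : forall k x, ip f (T x) (y k) = ip f x (z k).
Hypothesis y_small : forall k, 16 * sqn f (y k) <= defect T k.
Hypothesis T'E : forall k, T' k = T k + (y k - T (z k)).

(** The perturbation of [T x] lies in the range of the squared defect operator
    of the adjoint and is controlled by [defect T x], so by [julia_le]
    the defect of [T'] is still a positive fraction of that of [T]. *)
Lemma perturbation_contraction : op_contraction T'.
Proof.
move=> k; rewrite -(sqn_le f_norm) T'E.
have := julia_le k (yz k); have := y_small k; have := defect_ge0 k.
by have := sqn_ge0 f (y k); lra.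
Qed.

Lemma perturbation_defect k : defect T' k <= 3 * defect T k.
Proof.
rewrite {1}/defect T'E; have := julia_ge k (yz k).
by have := y_small k; have := defect_ge0 k; lra.
Qed.

(** The differences [d n] of the orbit sums satisfy [d n.+1 = w *: (T (d n) + e)]
    with [e = y s' - T (z s')]. By [julia_le] each step thus gains at most [sqn (y s')], a sixteenth
    of [defect T s'] for [s' = s n + d n], and loses half of [defect T (d n)], which
    absorbs the part of the gain that comes from [d n] itself. *)
Lemma orbit_sum_diff w x n : normc w = 1 ->
  4 * sqn f (orbit_sum T' w x n - orbit_sum T w x n) +
    \sum_(j < n) defect T (orbit_sum T' w x j - orbit_sum T w x j) <=
  \sum_(j < n) defect T (orbit_sum T w x j).
Proof.
move=> w1; set s := orbit_sum T w x.
pose d j := orbit_sum T' w x j - s j; rewrite -/(d n).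
elim: n => [|n IH].
  by rewrite !big_ord0 /d /s /= subrr /sqn /ip linear0l mulr0 addr0.
rewrite !big_ord_recr /=; set s' := orbit_sum T' w x n.
have -> : sqn f (d n.+1) = sqn f (T (d n) + (y s' - T (z s'))).
  rewrite [LHS](_ : _ = sqn f (w *: (T (d n) + (y s' - T (z s'))))); last first.
    congr (sqn f _); rewrite /d /s !orbit_sumS opprD addrACA subrr add0r.
    rewrite -scalerBr T'E -/s'.
    by rewrite [T (_ - _)]linearB /= addrAC.
  by rewrite sqnZ w1 expr1n mul1r.
have := julia_le (d n) (yz s'); have := y_small s'.
have := defectD_le (s n) (d n); rewrite (_ : s n + d n = s'); last first.
  by rewrite /d addrC subrK.
have := defect_ge0 (d n); have := defect_ge0 (s n); lra.
Qed.

Lemma perturbation_fejer w x n : normc w = 1 ->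
  fejer_form T' w x n <= 12 * fejer_form T w x n.
Proof.
move=> w1; have := orbit_sum_diff x n w1; rewrite /fejer_form.
set s := orbit_sum T w x; set s' := orbit_sum T' w x => diff.
have le1 : sqn f (s' n) <= 2 * sqn f (s n) + 2 * sqn f (s' n - s n).
  have := sqn_ge0 f (s n - (s' n - s n)); rewrite -{2}(subrK (s n) (s' n)).
  by move: (s' n - s n) => d; rewrite sqnB sqnD (ipC f d); lra.
have le2 : \sum_(j < n) defect T' (s' j) <=
    6 * \sum_(j < n) defect T (s j) + 6 * \sum_(j < n) defect T (s' j - s j).
  rewrite !mulr_sumr -big_split; apply: ler_sum => j _ /=.
  have := perturbation_defect (s' j); have := defectD_le (s j) (s' j - s j).
  by rewrite [s j + _]addrC subrK; lra.
have : 0 <= \sum_(j < n) defect T (s' j - s j).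
  by apply: sumr_ge0 => j _; exact: defect_ge0.
have := sqn_ge0 f (s n); have := sqn_ge0 f (s' n - s n); lra.
Qed.

End Perturbation.
End Contraction.
End Functional.

(** * Averages over roots of unity *)

(** A term bounded independently of [n] is negligible against [n] times another. *)
Lemma archi_ge0 (R : realType) (a b : R) N :
  (forall n, (N <= n)%N -> b <= n%:R * a) -> 0 <= a.
Proof.
move=> lb; rewrite leNgt; apply/negP => a0.
have b0 : 0 <= `|b| / - a by rewrite divr_ge0 // oppr_ge0 ltW.
pose n := maxn N (Num.bound (`|b| / - a)).
have := lb n (leq_maxl _ _).
have : `|b| / - a < n%:R.
  by apply: lt_le_trans (archi_boundP b0) _; rewrite ler_nat leq_maxr.
rewrite ltr_pdivrMr ?oppr_gt0 //; have := ler_norm (- b); rewrite normrN; lra.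
Qed.

Lemma prim_root_exists (C : numClosedFieldType) n : (0 < n)%N ->
  exists z : C, n.-primitive_root z.
Proof.
move=> n_gt0; have [s sE] := closed_field_poly_normal ('X^n - 1 : {poly C}).
have {}sE : 'X^n - 1 = \prod_(z <- s) ('X - z%:P).
  by rewrite [LHS]sE (monicP _) ?monicXnsubC // scale1r.
have s_unity : all n.-unity_root s.
  by apply/allP => z zs; rewrite /root_of_unity sE root_prod_XsubC.
have s_uniq : uniq s.
  by rewrite -separable_prod_XsubC -sE separable_Xn_sub_1 // pnatr_eq0 -lt0n.
have s_size : size s = n.
  by apply: succn_inj; rewrite -(size_prod_XsubC s id) -sE size_XnsubC.
have /hasP[z _ z_prim] := has_prim_root n_gt0 s_unity s_uniq (eq_leq (esym s_size)).
by exists z.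
Qed.

Section RootsOfUnity.
Variables (R : realType) (M : nat) (r : R[i]).
Hypothesis r_prim : M.-primitive_root r.

Lemma normc_prim_root_expr t : normc (r ^+ t) = 1.
Proof.
have M0 := prim_order_gt0 r_prim.
have /eqP : `|r ^+ t| == 1.
  by rewrite -(pexpr_eq1 M0) // -normrX exprAC (prim_expr_order r_prim)
    expr1n normr1.
by move/complexI.
Qed.

(** Orthogonality of characters: discrete averages over the powers of [r]
    extract Fourier coefficients, with no integration over the circle. *)
Lemma prim_root_orthogonality a b : (a < M)%N -> (b < M)%N ->
  \sum_(t < M) (r ^+ t) ^+ a * (r ^+ t)^* ^+ b = (a == b)%:R * M%:R.
Proof.
move=> aM bM; have rr : r * r^* = 1.
  by rewrite -normCK -[r]expr1 -[`|_|]/((normc _)%:C) normc_prim_root_expr expr1n.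
pose e := r ^+ a * r^* ^+ b.
under eq_bigr => t _.
  rewrite rmorphXn /= !(exprAC _ t) -exprMn -/e.
  over.
have [ab|ab] := eqVneq a b.
  rewrite mul1r (_ : e = 1); last by rewrite /e ab -exprMn rr expr1n.
  by under eq_bigr do rewrite expr1n; rewrite sumr_const card_ord.
have e1 : e - 1 != 0.
  apply: contra ab; rewrite subr_eq0 => /eqP e1.
  have : r ^+ a == r ^+ b.
    by rewrite -[r ^+ b]mul1r -e1 /e -mulrA -exprMn [_ * r]mulrC rr expr1n mulr1.
  by rewrite (eq_prim_root_expr r_prim) !modn_small.
rewrite mul0r; apply: (mulfI e1); rewrite mulr0 -subrX1 /e exprMn.
rewrite !(exprAC _ _ M) -rmorphXn /= (prim_expr_order r_prim).
by rewrite conjC1 !expr1n mulr1 subrr.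
Qed.

Lemma prim_root_sum a : (0 < a < M)%N -> \sum_(t < M) (r ^+ t) ^+ a = 0.
Proof.
case/andP => a0 aM; have := prim_root_orthogonality aM (ltn_trans a0 aM).
rewrite gtn_eqF // mul0r.
by under eq_bigr do rewrite expr0 mulr1.
Qed.

End RootsOfUnity.

Section Averages.
Variables (R : realType) (H : completeNormedModType R[i]).
Variable f : {dot H for Num.conj}.
Implicit Types (x y : H) (p : {poly R[i]}).

Lemma form_fejer (T : H -> H) n w x m : (n <= m)%N ->
  f (op_horner (fejer n w) T x) x =
  \sum_(k < m) (fejer_coef n k)%:R * (w ^+ k * f (iter k T x) x).
Proof.
move=> nm; rewrite (op_hornerE _ _ (leq_trans (size_poly _ _) nm)).
rewrite (big_morph (f^~ x) (fun u v => formDl f u v x) (linear0l _ _)).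
apply: eq_bigr => k _; rewrite coef_poly formZl; case: ltnP => [_|nk].
  by rewrite -mulr_natl mulrA.
by rewrite mul0r /fejer_coef (eqP nk) mul0n mul0r.
Qed.

Lemma ip_fejer (T : H -> H) n w x m : (n <= m)%N ->
  ip f (op_horner (fejer n w) T x) x =
  complex.Re (\sum_(k < m) (fejer_coef n k)%:R * (w ^+ k * f (iter k T x) x)).
Proof. by move=> nm; rewrite /ip (form_fejer _ _ _ nm). Qed.

(** Averaging [<fejer (w T) (h - w g), h - w g>] over the circle keeps only the
    Fourier coefficients 0 and 1 of the powers of [T]. This replaces the scalar
    test polynomials by one quadratic form in the pair [(h, g)]. *)
Lemma fejer_average_vector (T : {linear H -> H}) n (h g : H) (r : R[i]) :
  n.+3.-primitive_root r ->
  \sum_(t < n.+3) ip f (op_horner (fejer n.+1 (r ^+ t)) T (h - r ^+ t *: g))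
                      (h - r ^+ t *: g) =
  n.+3%:R * (n.+1%:R * (sqn f h + sqn f g) - 2 * n%:R * ip f (T h) g).
Proof.
move=> r_prim.
have ww t : r ^+ t * (r ^+ t)^* = 1.
  by rewrite -normCK -[`|_|]/((normc _)%:C) (normc_prim_root_expr r_prim) expr1n.
pose F k x y := (fejer_coef n.+1 k)%:R * f (iter k T x) y.
have sum_k k : (k < n.+2)%N ->
    \sum_(t < n.+3) (fejer_coef n.+1 k)%:R * ((r ^+ t) ^+ k *
      f (iter k T (h - r ^+ t *: g)) (h - r ^+ t *: g)) =
    n.+3%:R * ((k == 0%N)%:R * (F k h h + F k g g) - (k == 1%N)%:R * F k h g).
  move=> kn.
  have iterL a x y : iter k T (x + a *: y) = iter k T x + a *: iter k T y.
    by elim: k {kn} => //= k ->; rewrite linearD linearZ.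
  have expand w : f (iter k T (h - w *: g)) (h - w *: g) =
      f (iter k T h) h - w^* * f (iter k T h) g - w * f (iter k T g) h
      + w * w^* * f (iter k T g) g.
    rewrite -scaleNr iterL formDl !formDr !formZl !formZr rmorphN /=; ring.
  have E0 := prim_root_orthogonality r_prim (leqW kn) (ltn0Sn _).
  have E1 := prim_root_orthogonality r_prim (leqW kn) (isT : 1 < n.+3)%N.
  have E2 := prim_root_sum r_prim (a := k.+1) kn.
  transitivity ((\sum_(t < n.+3) (r ^+ t) ^+ k * (r ^+ t)^* ^+ 0) *
      (F k h h + F k g g)
      - (\sum_(t < n.+3) (r ^+ t) ^+ k * (r ^+ t)^* ^+ 1) * F k h g
      - (\sum_(t < n.+3) (r ^+ t) ^+ k.+1) * F k g h); last first.
    by rewrite E0 E1 E2; ring.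
  rewrite !mulr_suml -!sumrB; apply: eq_bigr => t _.
  by rewrite expand (ww t) /F expr0 expr1 exprS; ring.
transitivity (\sum_(t < n.+3) complex.Re (\sum_(k < n.+2)
    (fejer_coef n.+1 k)%:R * ((r ^+ t) ^+ k *
      f (iter k T (h - r ^+ t *: g)) (h - r ^+ t *: g)))).
  by apply: eq_bigr => t _; apply: ip_fejer.
rewrite -Re_sum exchange_big /=.
under eq_bigr => k _ do rewrite sum_k //.
rewrite !big_ord_recl big1 => [|k _] /=; last first.
  by rewrite !mul0r subrr mulr0.
rewrite mul1r !mul0r subr0 add0r mul1r addr0 /F /fejer_coef subn0 subn1 muln1 /=.
rewrite !(ReD, ReN, ReM_nat) -/(ip f h h) -/(ip f g g) -/(ip f (T h) g).
by rewrite natrM /sqn; ring.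
Qed.

(** Averaging against the values of [Re p] on the circle turns the Fejer
    polynomials of [T] into the Cesaro means of the series [p(T)]. *)
Lemma fejer_average_poly (T : H -> H) n p x (r : R[i]) :
  (n.+1 + n.+1).-primitive_root r -> (size p <= n.+1)%N ->
  \sum_(t < n.+1 + n.+1) complex.Re p.[(r ^+ t)^*] *
      ip f (op_horner (fejer n.+1 (r ^+ t)) T x) x =
  (n.+1 + n.+1)%:R *
    \sum_(k < n.+1) (n.+1 - k)%:R * complex.Re (p`_k * f (iter k T x) x).
Proof.
move=> r_prim size_p.
pose F k := (fejer_coef n.+1 k)%:R * f (iter k T x) x.
pose M := (n.+1 + n.+1)%N.
pose a t := p.[(r ^+ t)^*].
pose b t := \sum_(k < n.+1) F k * (r ^+ t) ^+ k.
have aE t : a t = \sum_(m < n.+1) p`_m * (r ^+ t)^* ^+ m.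
  exact: horner_coef_wide.
have bE t : ip f (op_horner (fejer n.+1 (r ^+ t)) T x) x = complex.Re (b t).
  rewrite (ip_fejer _ _ _ (leqnn _)); congr complex.Re.
  by apply: eq_bigr => k _; rewrite mulrCA mulrC.
have ltM (k : 'I_n.+1) : (k < M)%N.
  by rewrite /M; apply: leq_trans (ltn_ord k) _; exact: leq_addr.
have E1 : \sum_(t < M) a t * b t = M%:R * \sum_(k < n.+1) p`_k * F k.
  under eq_bigr do rewrite aE big_distrlr /=.
  rewrite exchange_big mulr_sumr; apply: eq_bigr => m _.
  rewrite exchange_big (bigD1 m) //= [X in _ + X]big1 => [|k km].
    transitivity (p`_m * F m * \sum_(t < M) (r ^+ t) ^+ m * (r ^+ t)^* ^+ m).
      rewrite addr0 mulr_sumr; apply: eq_bigr => t _; ring.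
    by rewrite (prim_root_orthogonality r_prim) // eqxx mul1r mulrC.
  transitivity (p`_m * F k * \sum_(t < M) (r ^+ t) ^+ k * (r ^+ t)^* ^+ m).
    by rewrite mulr_sumr; apply: eq_bigr => t _; ring.
  rewrite (prim_root_orthogonality r_prim) //.
  by rewrite (negPf (km : nat_of_ord k != m)) mul0r mulr0.
(* The conjugate half of [Re p] has frequencies of the same sign as [b], so
   it only meets [b] in the constant term. *)
have E2 : \sum_(t < M) (a t)^* * b t = M%:R * ((p`_0)^* * F 0).
  have aJ t : (a t)^* = \sum_(m < n.+1) (p`_m)^* * (r ^+ t) ^+ m.
    rewrite aE rmorph_sum; apply: eq_bigr => m _.
    by rewrite rmorphM rmorphXn; congr (_ * _ ^+ _); exact: conjCK.
  under eq_bigr do rewrite aJ big_distrlr /=.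
  have vanish (m k : 'I_n.+1) : (0 < k + m)%N ->
      \sum_(t < M) (p`_m)^* * (r ^+ t) ^+ m * (F k * (r ^+ t) ^+ k) = 0.
    move=> km; transitivity ((p`_m)^* * F k * \sum_(t < M) (r ^+ t) ^+ (k + m)).
      by rewrite mulr_sumr; apply: eq_bigr => t _; rewrite exprD; ring.
    rewrite (prim_root_sum r_prim) ?mulr0 // km /= -addSn /M.
    by apply: leq_add => //; exact: ltnW.
  rewrite exchange_big (bigD1 ord0) //= [X in _ + X]big1 => [|m m0]; last first.
    by rewrite exchange_big big1 // => k _; rewrite vanish // addn_gt0 orbC lt0n m0.
  rewrite exchange_big (bigD1 ord0) //= [X in _ + X + _]big1 => [|k k0]; last first.
    by apply: (vanish ord0); rewrite addn0 lt0n.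
  rewrite !addr0; under eq_bigr do rewrite !expr0 !mulr1.
  by rewrite sumr_const card_ord mulr_natl.
under eq_bigr do rewrite bE -/(a _).
have two : (2 : R) != 0 by [].
apply: (mulfI two); rewrite mulr_sumr.
transitivity (complex.Re (\sum_(t < M) a t * b t + \sum_(t < M) (a t)^* * b t)).
  rewrite -big_split Re_sum; apply: eq_bigr => t _ /=; rewrite -mulrDl.
  by case: (a t) (b t) => [a1 a2] [b1 b2] /=; ring.
rewrite E1 E2 -mulrDr ReM_nat [RHS]mulrCA -/M; congr (_ * _).
rewrite ReD Re_sum !big_ord_recl /= mulrDr mulr_sumr addrAC; congr (_ + _).
  rewrite /F /fejer_coef !subn0 muln1 /= form_sqn.
  by rewrite !(mulrCA _ n.+1%:R) !ReM_nat; case: (p`_0) => a1 a2 /=; ring.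
apply: eq_bigr => k _; rewrite /F /fejer_coef /bump /= !add1n /=.
by rewrite mulrCA ReM_nat natrM; ring.
Qed.

End Averages.

(** * Harnack domination *)

Section Harnack.
Variables (R : realType) (H : completeNormedModType R[i]).
Variable f : {dot H for Num.conj}.
Hypothesis f_norm : dot_norm f.
Implicit Types (x y : H) (p : {poly R[i]}) (S T : {linear H -> H}).

Lemma form_op_Re (A : H -> H) x : has_adjoint f A ->
  f (op_Re f A x) x = (ip f (A x) x)%:C.
Proof.
move=> hA; rewrite /op_Re formZl formDl.
rewrite (form_conj f (adjoint f A x)) -(adjointP hA) /ip.
have two0 : (2 : R[i]) != 0 by [].
apply: (mulfI two0); rewrite mulrA divff // mul1r; exact: addcJ.
Qed.

Lemma harnack_dominatedP S T : op_contraction S -> op_contraction T ->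
  harnack_dominated f S T <-> exists c : R, 1 <= c /\
    forall p, (forall z, `|z| <= 1 -> 0 <= complex.Re p.[z]) ->
    forall x, ip f (op_horner p S x) x <= c * ip f (op_horner p T x) x.
Proof.
move=> S_contr T_contr.
have adj (A : {linear H -> H}) p : op_contraction A ->
    has_adjoint f (op_horner p A).
  by move=> A_contr; apply: has_adjoint_horner; exact: contraction_has_adjoint.
have leE c p x : (0 <= f (c%:C *: op_Re f (op_horner p T) x -
      op_Re f (op_horner p S) x) x) =
    (ip f (op_horner p S x) x <= c * ip f (op_horner p T x) x).
  rewrite formDl -scaleN1r (formZl f c%:C) (formZl f (-1)).
  rewrite !form_op_Re; try exact: adj.
  by rewrite mulN1r -rmorphM -rmorphB /= ler0c subr_ge0.
by split=> -[c [c1 dom]]; exists c; split=> // p p_pos x;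
  have := dom p p_pos x; rewrite leE.
Qed.

(** Apply the domination to Fejer polynomials at [h - w *: T h] and average over
    [w]. On the side of [T] the two leading terms in [n] cancel because [T] keeps
    the norm of [h], so the side of [S], which is
    [2 * n * (sqn h - ip (S h) (T h))] up to a bounded term, stays bounded. Hence
    [sqn h <= ip (S h) (T h)], the equality case of Cauchy-Schwarz. *)
Lemma harnack_rigidity S T h : op_contraction S -> op_contraction T ->
  harnack_dominated f S T -> sqn f (T h) = sqn f h -> S h = T h.
Proof.
move=> S_contr T_contr /(harnack_dominatedP S_contr T_contr) [c [_ dom]] Th.
have key n : (1 - c) * sqn f h <= n%:R * (ip f (S h) (T h) - sqn f h).
  have [r r_prim] := prim_root_exists R[i] (isT : 0 < n.+3)%N.
  have : \sum_(t < n.+3) ip f (op_horner (fejer n.+1 (r ^+ t)) S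
        (h - r ^+ t *: T h)) (h - r ^+ t *: T h) <=
      c * \sum_(t < n.+3) ip f (op_horner (fejer n.+1 (r ^+ t)) T
        (h - r ^+ t *: T h)) (h - r ^+ t *: T h).
    rewrite mulr_sumr; apply: ler_sum => t _; apply: dom => z z1.
    by apply: fejer_Re_ge0 => //; exact: (normc_prim_root_expr r_prim).
  rewrite !(fejer_average_vector f _ _ _ r_prim) -/(sqn f (T h)) Th.
  rewrite mulrCA ler_pM2l ?ltr0n // -[n.+1%:R]natr1; lra.
have ip_ge : 0 <= ip f (S h) (T h) - sqn f h.
  by apply: (@archi_ge0 _ _ ((1 - c) * sqn f h) 0) => n _; exact: key.
apply/subr0_eq/(@sqn_eq0 _ _ f)/le_anti; rewrite sqn_ge0 andbT sqnB Th.
by have := contraction_sqn f_norm S_contr h; lra.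
Qed.

Lemma isometric_minimal T : op_contraction T -> isometric T ->
  harnack_minimal f T.
Proof.
move=> T_contr T_iso S S_contr dom h.
by apply: (harnack_rigidity S_contr T_contr dom); exact/(sqn_eq f_norm).
Qed.

(** [T] is isometric on the range of its adjoint [Ts], so [harnack_rigidity]
    gives [S (Ts y) = T (Ts y) = y] for all [y]. Then the adjoint of [S], being a
    contraction, must send [y] to [Ts y], again by the equality case of
    Cauchy-Schwarz. *)
Lemma coisometric_minimal T : op_contraction T -> coisometric f T ->
  harnack_minimal f T.
Proof.
move=> T_contr T_coiso S S_contr dom.
have adjT := adjointP (contraction_has_adjoint f_norm T_contr).
have adjS := adjointP (contraction_has_adjoint f_norm S_contr).
have sqT y : sqn f (adjoint f T y) = sqn f y by exact/(sqn_eq f_norm).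
have TTs y : T (adjoint f T y) = y.
  apply/subr0_eq/(@sqn_eq0 _ _ f)/le_anti; rewrite sqn_ge0 andbT sqnB.
  have := contraction_sqn f_norm T_contr (adjoint f T y).
  by rewrite /ip adjT -/(ip f _ _) -/(sqn f _) sqT; lra.
have STs y : S (adjoint f T y) = y.
  by rewrite (harnack_rigidity S_contr T_contr dom) TTs ?sqT.
have adjE y : adjoint f S y = adjoint f T y.
  apply/subr0_eq/(@sqn_eq0 _ _ f)/le_anti; rewrite sqn_ge0 andbT sqnB.
  have Ss_le : sqn f (adjoint f S y) <= sqn f y.
    by apply: (adjoint_sqn_le f_norm S_contr) => x; rewrite /ip adjS.
  by rewrite ipC /ip -adjS STs -/(sqn f y) sqT; lra.
move=> x; apply: (@form_inj _ _ f) => y.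
by rewrite form_conj adjS adjE -adjT -form_conj.
Qed.

(** Domination on the Fejer polynomials is enough: integrating it over the
    circle against the nonnegative weight [Re p] gives domination for the Cesaro
    means of [p], and these differ from [p] itself by a term of order [1 / n]. *)
Lemma fejer_domination S T (c : R) :
  (forall n w x, normc w = 1 -> ip f (op_horner (fejer n w) S x) x <=
    c * ip f (op_horner (fejer n w) T x) x) ->
  forall p, (forall z, `|z| <= 1 -> 0 <= complex.Re p.[z]) ->
  forall x, ip f (op_horner p S x) x <= c * ip f (op_horner p T x) x.
Proof.
move=> dom p p_pos x.
pose N := size p; pose B (A : H -> H) :=
  \sum_(k < N) k%:R * complex.Re (p`_k * f (iter k A x) x).
have sumE (A : H -> H) n : (N <= n)%N ->
    \sum_(k < n) (n - k)%:R * complex.Re (p`_k * f (iter k A x) x) =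
    n%:R * ip f (op_horner p A x) x - B A.
  move=> Nn; have -> : ip f (op_horner p A x) x =
      \sum_(k < N) complex.Re (p`_k * f (iter k A x) x).
    rewrite (op_hornerE _ _ (leqnn N)) -Re_sum /ip.
    rewrite (big_morph (f^~ x) (fun u v => formDl f u v x) (linear0l _ _)).
    by congr complex.Re; apply: eq_bigr => k _; exact: formZl.
  rewrite -(subnKC Nn) big_split_ord /= [X in _ + X]big1 => [|k _]; last first.
    by rewrite nth_default ?leq_addr // mul0r mulr0.
  rewrite addr0 mulr_sumr /B -sumrB; apply: eq_bigr => k _.
  rewrite subnKC // natrB; last by apply: leq_trans Nn; exact: ltnW.
  by rewrite mulrBl.
have key n : (N.+1 <= n)%N -> c * B T - B S <=
    n%:R * (c * ip f (op_horner p T x) x - ip f (op_horner p S x) x).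
  case: n => // n Nn; have Nn' : (N <= n.+1)%N by exact: ltnW.
  have [r r_prim] := prim_root_exists R[i] (isT : 0 < n.+1 + n.+1)%N.
  have : \sum_(t < n.+1 + n.+1) complex.Re p.[(r ^+ t)^*] *
        ip f (op_horner (fejer n.+1 (r ^+ t)) S x) x <=
      c * \sum_(t < n.+1 + n.+1) complex.Re p.[(r ^+ t)^*] *
        ip f (op_horner (fejer n.+1 (r ^+ t)) T x) x.
    rewrite mulr_sumr; apply: ler_sum => t _; rewrite mulrCA.
    have r1 := normc_prim_root_expr r_prim t.
    apply: ler_wpM2l; last exact: dom.
    by apply: p_pos; rewrite norm_conjC -[`|_|]/((normc _)%:C) r1.
  rewrite !(fejer_average_poly f _ _ r_prim) // mulrCA ler_pM2l ?ltr0n //.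
  by rewrite !sumE //; lra.
by have := archi_ge0 key; rewrite subr_ge0.
Qed.

Lemma linear_of (g : H -> H) : linear g -> exists T, T =1 g.
Proof.
move=> lin_g; pose m := GRing.isLinear.Build R[i] H H *:%R g lin_g.
by pose T : {linear H -> H} := HB.pack g m; exists T.
Qed.

(** Cauchy-Schwarz for the sesquilinear form of [1 - T^* T], with [defect T x]
    replaced by [sqn x + 1]: the proof divides by it, and [defect T x] may be 0. *)
Lemma defect_form_sqr T x k : op_contraction T ->
  normc (f k x - f (T k) (T x)) ^+ 2 <= (sqn f x + 1) * defect f T k.
Proof.
move=> T_contr; set D := f k x - f (T k) (T x).
have s0 := sqn_ge0 f x; pose s := (sqn f x + 1)^-1.
have s_gt0 : 0 < s by rewrite invr_gt0; lra.
have sE : s * (sqn f x + 1) = 1 by rewrite mulVf //; lra.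
have cross : ip f k (s%:C * D *: x) - ip f (T k) (s%:C * D *: T x) =
    s * normc D ^+ 2.
  rewrite /ip !formZr -ReN -ReD -mulrBr -/D rmorphM /= conj_real.
  by rewrite -mulrA ReM_real [_ * D]mulrC normc_sqr.
have := defect_ge0 f_norm T_contr (k - s%:C * D *: x).
have := defect_le f T x.
rewrite /defect (_ : T (k - _) = T k - s%:C * D *: T x); last first.
  by rewrite linearB linearZ.
rewrite !sqnB !sqnZ normcM exprMn.
have -> : normc s%:C ^+ 2 = s ^+ 2.
  by rewrite -normc_sqr conj_real /= mulr0 subr0.
move: cross; move: (normc D ^+ 2) (sqr_ge0 (normc D)) => d d0 cross dx_le quad.
have sd0 : 0 <= s * d by rewrite mulr_ge0 // ltW.
have le1 : s ^+ 2 * d * (sqn f x - sqn f (T x)) <= s * d.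
  rewrite expr2 -[s * s * d]mulrA [s * (s * d)]mulrC -mulrA ler_piMr //.
  by rewrite -sE ler_pM2l //; lra.
have -> : d = (sqn f x + 1) * (s * d) by rewrite mulrA [_ * s]mulrC sE mul1r.
by apply: ler_wpM2l; lra.
Qed.

(** The scale factor of the rank one perturbation below, with [X] and [Y] the
    squared norms of its two vectors and [q] the defect at a point. *)
Lemma rank_one_scale (X Y d q : R) : 0 <= X -> 0 <= Y -> 0 <= q ->
  d <= (X + 1) * q -> 16 * (((4 * (X + 1) * (Y + 1))^-1) ^+ 2 * d * Y) <= q.
Proof.
move=> X0 Y0 q0 dq; set e := _^-1.
have eE : 16 * e ^+ 2 * ((X + 1) ^+ 2 * (Y + 1) ^+ 2) = 1.
  by rewrite /e; field; lra.
have e2 : 0 <= 16 * e ^+ 2 by rewrite mulr_ge0 // sqr_ge0.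
have le1 : (X + 1) * Y <= (X + 1) ^+ 2 * (Y + 1) ^+ 2 by nra.
apply: (@le_trans _ _ (16 * e ^+ 2 * ((X + 1) * Y) * q)).
  by have := ler_wpM2l (mulr_ge0 e2 Y0) dq; lra.
by apply: ler_piMl => //; apply: le_trans (ler_wpM2l e2 le1) _; rewrite eE.
Qed.

(** With [u = (1 - T^* T) x] and [v = (1 - T T^* ) y] both nonzero, the rank one
    perturbation [k |-> T k + e * <k, u> v] is Harnack dominated by [T] for small
    [e]: the factor [<k, u>] is controlled by the defect of [T] and [v] has the
    form required by [julia]. *)
Lemma not_minimal T : op_contraction T -> ~ isometric T -> ~ coisometric f T ->
  ~ harnack_minimal f T.
Proof.
move=> T_contr /existsNP [x /(sqn_eq f_norm) Tx] /existsNP [y /(sqn_eq f_norm) Ty].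
move=> T_min.
have adjT := adjointP (contraction_has_adjoint f_norm T_contr).
(* Small enough for the factor 16 of the perturbation bounds. *)
pose e : R := (4 * (sqn f x + 1) * (sqn f y + 1))^-1.
have x0 := sqn_ge0 f x; have y0 := sqn_ge0 f y.
pose D k := f k x - f (T k) (T x).
pose a k := e%:C * D k.
pose v := y - T (adjoint f T y).
have e_gt0 : 0 < e by rewrite invr_gt0 !mulr_gt0 //; lra.
have [T' T'E] : exists T' : {linear H -> H}, T' =1 fun k => T k + a k *: v.
  apply: linear_of => b k l.
  have aP : a (b *: k + l) = b * a k + a l.
    by rewrite /a /D linearP !formDl !formZl; ring.
  rewrite /= aP (linearP T) scalerDl [b *: (_ + _)]scalerDr.
  by rewrite [b *: (_ *: _)]scalerA addrACA.
have yz k z : ip f (T z) (a k *: y) = ip f z (a k *: adjoint f T y).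
  by rewrite /ip !formZr adjT.
have y_small k : 16 * sqn f (a k *: y) <= defect f T k.
  rewrite sqnZ normcM exprMn.
  have -> : normc e%:C ^+ 2 = e ^+ 2.
    by rewrite -normc_sqr conj_real /= mulr0 subr0.
  have := defect_form_sqr x k T_contr; rewrite -/(D k).
  have := defect_ge0 f_norm T_contr k.
  exact: rank_one_scale.
have T'K k : T' k = T k + (a k *: y - T (a k *: adjoint f T y)).
  by rewrite T'E linearZ /= -scalerBr.
have T'_contr := perturbation_contraction f_norm T_contr yz y_small T'K.
have dom : harnack_dominated f T' T.
  apply/(harnack_dominatedP T'_contr T_contr); exists 12; split; first by lra.
  move=> p; apply: fejer_domination => n w z w1; rewrite !fejer_formE //.
  exact: perturbation_fejer yz y_small T'K _ _ _ w1.
have := T_min T' T'_contr dom x; rewrite T'E => /eqP.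
rewrite -subr_eq0 addrAC subrr add0r scaler_eq0 => /orP[|/eqP v0].
  rewrite mulf_eq0 (fmorph_eq0 (real_complex R)) gt_eqF //= /D !form_sqn -rmorphB.
  rewrite (fmorph_eq0 (real_complex R)) subr_eq0 => /eqP xT; exact: Tx.
apply: Ty.
have : ip f v y = 0 by rewrite v0 /ip linear0l.
rewrite /v ipDl ipNl -/(sqn f y) /ip adjT -/(ip f _ _) -/(sqn f _); lra.
Qed.

End Harnack.

Theorem corollary2p9 (R : realType) (H : completeNormedModType R[i])
    (f : {dot H for Num.conj}) (f_norm : dot_norm f)
    (T : {linear H -> H}) (T_contr : op_contraction T) :
  harnack_minimal f T <-> isometric T \/ coisometric f T.
Proof.
split=> [T_min|[T_iso|T_coiso]].
- have [?|nT] := pselect (isometric T); first by left.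
  have [?|nTs] := pselect (coisometric f T); first by right.
  by case: (not_minimal f_norm T_contr nT nTs).
- exact: isometric_minimal.
- exact: coisometric_minimal.
Qed.
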